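(* Let $X$ be a Banach space and let $x\in S_X$ be a Daugavet point. Then, for every slice $S$ of $B_X$ and every $\varepsilon>0$, there exists a slice $T$ of $B_X$ with $T\subset S$ such that $\|x+\theta y\|>2-\varepsilon$ for every $y\in T$ and every $\theta\in\mathbb{T}$.
   Context: Banach spaces are over $\mathbb{K}$ ($\mathbb{R}$ or $\mathbb{C}$); $B_X$, $S_X$ denote the closed unit ball and the unit sphere of $X$; $\mathbb{T}=\{\theta\in\mathbb{K}:|\theta|=1\}$. A slice of $B_X$ is a set of the form $\{y\in B_X:\mathrm{Re}\,x^*(y)>\sup\mathrm{Re}\,x^*(B_X)-\alpha\}$ with $x^*\in X^*\setminus\{0\}$ and $\alpha>0$. A point $x\in S_X$ is a Daugavet point if $\sup_{y\in S}\|x+y\|=2$ for every slice $S$ of $B_X$. *)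

(* Defs.v *)
From HB Require Import structures.
From mathcomp Require Import all_boot all_order all_algebra.
From mathcomp Require Import complex.
From mathcomp Require Import all_classical all_reals all_analysis.

Set Implicit Arguments.
Unset Strict Implicit.
Unset Printing Implicit Defensive.

Import Order.TTheory GRing.Theory Num.Theory.
Import numFieldNormedType.Exports.

Local Open Scope classical_set_scope.
Local Open Scope ring_scope.

Inductive scalar_kind := RealScalars | ComplexScalars.

Definition scalars (R : realType) (k : scalar_kind) : numFieldType :=
  match k with
  | RealScalars => R : numFieldType
  | ComplexScalars => R[i]%C : numFieldType
  end.

Definition re (R : realType) (k : scalar_kind) : scalars R k -> R :=
  match k with
  | RealScalars => fun z => z
  | ComplexScalars => fun z => complex.Re z
  end.

Section Slices.
Variables (R : realType) (k : scalar_kind).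
Local Notation K := (scalars R k).

(* The norm of a normedModType K takes its values in K (in its nonnegative real
   elements); suprema and strict inequalities are taken in R. *)
Definition rnorm (X : normedModType K) (x : X) : R := re `|x|.

Definition unit_ball (X : normedModType K) : set X := [set x | rnorm x <= 1].

Definition unit_sphere (X : normedModType K) : set X := [set x | rnorm x = 1].

Definition slice (X : normedModType K) (f : {scalar X}) (alpha : R) : set X :=
  [set y | unit_ball y /\
           re (f y) > sup [set re (f z) | z in @unit_ball X] - alpha].

Definition is_slice (X : normedModType K) (S : set X) : Prop :=
  exists (f : {scalar X}) (alpha : R),
    [/\ continuous f, (f : X -> K) <> cst 0, 0 < alpha & S = slice f alpha].

(* sup is total on sets of reals; here and in slice it is only taken of nonempty
   bounded sets, f being continuous and slices of the ball being nonempty. *)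
Definition daugavet_point (X : normedModType K) (x : X) : Prop :=
  unit_sphere x /\
  forall S : set X, is_slice S -> sup [set rnorm (x + y) | y in S] = 2.

End Slices.

(* Main.v *)
(* For [theta = 1]: shrink the slice of [f] to depth [d], choose [y] in it with
   [|x + y| > 2 - d] and a functional [g] of norm at most one with
   [re (g (x + y)) = |x + y|]. Since [re f] is nearly maximal and [re g] nearly [1]
   at [y], the slice of [f + g] around [y] only contains points where both are
   nearly maximal; there [|x + z| >= re (g (x + z))] is close to [2]. Rotating slices
   gives the same for each fixed [theta], and shrinking successively along a finite
   net of the unimodular scalars handles all [theta] at once. *)

Require Import Defs.
From HB Require Import structures.
From mathcomp Require Import all_boot all_order all_algebra.
From mathcomp Require Import complex.
From mathcomp Require Import all_classical all_reals all_analysis.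
From mathcomp Require Import ring lra.

Set Implicit Arguments.
Unset Strict Implicit.

Import Order.TTheory GRing.Theory Num.Theory.
Import numFieldNormedType.Exports.

Local Open Scope classical_set_scope.
Local Open Scope ring_scope.

(** * Hahn-Banach theorem for real sublinear functionals *)

Section HahnBanach.
Variables (R : realType) (V : lmodType R).
Implicit Types p q : V -> R.

(** Homogeneity is asked as an inequality, the form that passes to infima; [sublinearZ] recovers
    equality by scaling back with [a^-1]. *)
Definition sublinear p :=
  (forall x y, p (x + y) <= p x + p y) /\
  (forall a x, 0 <= a -> p (a *: x) <= a * p x).

Lemma sublinearZ p a x : sublinear p -> 0 <= a -> p (a *: x) = a * p x.
Proof.
move=> [padd phom]; rewrite le_eqVlt => /predU1P[<-|a0].
  have := phom 0 x (lexx _); have := padd 0 0.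
  by rewrite scale0r addr0 mul0r; lra.
apply/eqP; rewrite eq_le phom ?(ltW a0)//= -ler_pdivlMl//.
apply: le_trans (phom _ _ _); last by rewrite invr_ge0 ltW.
by rewrite scalerA mulVf ?gt_eqF// scale1r.
Qed.

Lemma sublinear0 p : sublinear p -> p 0 = 0.
Proof. by move=> sp; rewrite -(scale0r 0) sublinearZ// mul0r. Qed.

Lemma sublinear_opp p x : sublinear p -> - p (- x) <= p x.
Proof.
move=> sp; have := sp.1 x (- x).
by rewrite subrr (sublinear0 sp); lra.
Qed.

(** No single [F i] has to be sublinear, and [l] may depend on the points. This covers both the
    infimum of a chain and an infimum over translates. *)
Lemma sublinear_inf (I : Type) (i0 : I) (F : I -> V -> R) :
  (forall x, has_lbound [set F i x | i in setT]) ->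
  (forall i j x y, exists l, F l (x + y) <= F i x + F j y) ->
  (forall i a x, 0 < a -> exists l, F l (a *: x) <= a * F i x) ->
  F i0 0 <= 0 ->
  sublinear (fun x => inf [set F i x | i in setT]).
Proof.
move=> lb Fadd Fhom F0.
have infle i x : inf [set F j x | j in setT] <= F i x.
  by apply: ge_inf => //; exists i.
have leinf x z : (forall i, z <= F i x) -> z <= inf [set F j x | j in setT].
  move=> h; apply: lb_le_inf; first by exists (F i0 x), i0.
  by move=> _ [i _ <-].
split=> [x y|a x].
  rewrite -lerBlDr; apply: (leinf) => i; rewrite lerBlDr -lerBlDl.
  apply: (leinf) => j; rewrite lerBlDl.
  by have [l] := Fadd i j x y; apply: le_trans.
rewrite le_eqVlt => /predU1P[<-|a0].
  by rewrite scale0r mul0r (le_trans (infle i0 _)).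
rewrite -ler_pdivrMl//; apply: (leinf) => i; rewrite ler_pdivrMl//.
by have [l] := Fhom i a x a0; apply: le_trans.
Qed.

(** Zorn's lemma on the sublinear minorants of [p0]. A nonempty chain is bounded by its pointwise
    infimum, which is finite because a minorant [s] satisfies [s x >= - s (- x) >= - p0 (- x)]. *)
Lemma minimal_sublinear p0 : sublinear p0 ->
  exists p, [/\ sublinear p, forall x, p x <= p0 x &
    forall q, sublinear q -> (forall x, q x <= p x) -> forall x, p x <= q x].
Proof.
move=> sp0.
pose T := {p | sublinear p /\ forall x, p x <= p0 x}.
pose mk p sp pp0 : T := exist _ p (conj sp pp0).
(* The order is reversed, so that a maximal element for [r] is pointwise minimal. *)
pose r (s t : T) := `[< forall x, sval t x <= sval s x >].
have [||A Atot|[p [sp pp0]] pmin] := @ZL_preorder T (mk p0 sp0 (fun=> lexx _)) r.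
- by move=> t; apply/asboolP.
- by move=> s t u /asboolP h /asboolP h'; apply/asboolP => x; exact: le_trans (h x).
- have [[s0 As0]|A0] := pselect (exists s, A s); last first.
    exists (mk p0 sp0 (fun=> lexx _)) => s As.
    by case: A0; exists s.
  pose I := {s | A s}; pose F (i : I) x := sval (sval i) x.
  have lb x : has_lbound [set F i x | i in setT].
    exists (- p0 (- x)) => _ [[[s [ss sp]] As] _ <-]; rewrite /F/=.
    by apply: le_trans (sublinear_opp x ss); rewrite lerN2.
  have sinf : sublinear (fun x => inf [set F i x | i in setT]).
    apply: (@sublinear_inf _ (exist _ s0 As0)) => //.
    + move=> [s As] [t At] x y; have [st|ts] := Atot _ _ As At.
        exists (exist _ t At); rewrite /F/=; apply: le_trans ((svalP t).1.1 x y) _.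
        by rewrite lerD2r; apply: (asboolW st).
      exists (exist _ s As); rewrite /F/=; apply: le_trans ((svalP s).1.1 x y) _.
      by rewrite lerD2l; apply: (asboolW ts).
    + move=> i a x a0; exists i.
      by rewrite /F sublinearZ ?(ltW a0)//; exact: (svalP (sval i)).1.
    + by rewrite /F/= sublinear0//; exact: (svalP s0).1.
  have infle s x : A s -> inf [set F j x | j in setT] <= sval s x.
    by move=> As; apply: ge_inf => //; exists (exist _ s As).
  have infp0 x : inf [set F i x | i in setT] <= p0 x.
    by apply: le_trans (infle _ x As0) _; exact: (svalP s0).2.
  by exists (mk _ sinf infp0) => s As; apply/asboolP => x; exact: infle.
- exists p; split => // q sq qp.
  have qp0 x : q x <= p0 x by exact: le_trans (qp x) (pp0 x).
  have /asboolP := pmin (mk q sq qp0) (introT (asboolP _) qp).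
  exact.
Qed.

(* The infimum of [p (x + t y) - t p y] over [t >= 0] is a sublinear minorant of
   [p] whose value at [- y] is at most [- p y]. *)
Lemma sublinear_minorant p y : sublinear p ->
  exists q, [/\ sublinear q, forall x, q x <= p x & q (- y) <= - p y].
Proof.
move=> sp; pose I := {t : R | 0 <= t}.
pose mk t t0 : I := exist _ t t0.
pose F (t : I) x := p (x + sval t *: y) - sval t * p y.
(* Here [t * p y = p (t *: y) <= p (x + t *: y) + p (- x)], which gives a bound independent of
   [t]. *)
have lb x : has_lbound [set F i x | i in setT].
  exists (- p (- x)) => _ [[t t0] _ <-]; rewrite /F/= -(sublinearZ _ sp t0).
  by have := sp.1 (x + t *: y) (- x); rewrite addrC addKr; lra.
have h1 : 0 <= 1 :> R by [].
exists (fun x => inf [set F i x | i in setT]); split.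
- apply: (@sublinear_inf I (mk 0 (lexx 0))) => //.
  + move=> [t t0] [s s0] x z; exists (mk _ (addr_ge0 t0 s0)); rewrite /F/=.
    have := sp.1 (x + t *: y) (z + s *: y).
    by rewrite addrACA -scalerDl mulrDl; lra.
  + move=> [t t0] a x a0; exists (mk _ (mulr_ge0 (ltW a0) t0)); rewrite /F/=.
    by rewrite -scalerA -scalerDr (sublinearZ _ sp (ltW a0)) mulrBr mulrA.
  + by rewrite /F/= scale0r addr0 sublinear0// mul0r subr0.
- move=> x; have -> : p x = F (mk 0 (lexx 0)) x.
    by rewrite /F/= scale0r addr0 mul0r subr0.
  by apply: ge_inf => //; exists (mk 0 (lexx 0)).
- have -> : - p y = F (mk 1 h1) (- y).
    by rewrite /F/= scale1r addNr sublinear0// mul1r sub0r.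
  by apply: ge_inf => //; exists (mk 1 h1).
Qed.

(* A minimal sublinear functional is odd, hence linear; minimizing below the minorant
   of [p] at [v] forces the value at [v]. *)
Lemma sublinear_hahn_banach p v : sublinear p ->
  exists u : {scalar V}, (forall x, u x <= p x) /\ u v = p v.
Proof.
move=> sp; have [q [sq qp qv]] := sublinear_minorant v sp.
have [u [su uq umin]] := minimal_sublinear sq.
have uN x : u (- x) = - u x.
  apply/eqP; rewrite eq_le; apply/andP; split; last first.
    by rewrite lerNl; exact: sublinear_opp.
  (* Minimality puts [u] below its own minorant [w], hence [u (- x) <= w (- x) <= - u x]. *)
  have [w [sw wu wx]] := sublinear_minorant x su.
  exact: le_trans (umin w sw wu _) wx.
have uD x y : u (x + y) = u x + u y.
  apply/eqP; rewrite eq_le su.1/=.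
  by have := su.1 (x + y) (- y); rewrite addrK uN; lra.
have uZ a x : u (a *: x) = a * u x.
  have [a0|a0] := leP 0 a; first exact: sublinearZ.
  rewrite -[a in LHS]opprK scaleNr uN (sublinearZ _ su) ?oppr_ge0 ?ltW//.
  by rewrite mulNr opprK.
have ulin : linear_for *%R u by move=> a x y; rewrite uD uZ.
pose L := GRing.isLinear.Build R V R *%R u ulin.
pose f : {scalar V} := HB.pack u L.
exists f; split=> [x|]; first exact: le_trans (uq x) (qp x).
(* The reverse inequality at [v] is [- u v = u (- v) <= q (- v) <= - p v]. *)
apply/eqP; rewrite eq_le (le_trans (uq v) (qp v))/=.
by rewrite -lerN2 /= -uN (le_trans (uq _)).
Qed.

End HahnBanach.

(** * Real and complex scalars treated uniformly *)

Section Scalars.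
Variables (R : realType) (k : scalar_kind).
Local Notation K := (scalars R k).
Implicit Types (z w : K) (a : R).

Definition of_real a : K :=
  match k as k0 return scalars R k0 with
  | RealScalars => a
  | ComplexScalars => a%:C%C
  end.

Lemma of_realK a : re (of_real a) = a.
Proof. by rewrite /of_real; case: k. Qed.

Lemma of_realD a b : of_real (a + b) = of_real a + of_real b.
Proof. by rewrite /of_real; case: k => //=; rewrite rmorphD. Qed.

Lemma of_realM a b : of_real (a * b) = of_real a * of_real b.
Proof. by rewrite /of_real; case: k => //=; rewrite rmorphM. Qed.

Lemma of_real1 : of_real 1 = 1.
Proof. by rewrite /of_real; case: k. Qed.

Lemma reD z w : re (z + w) = re z + re w.
Proof. by case: k z w => //= -[? ?] [? ?]. Qed.

Lemma re0 : re (0 : K) = 0.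
Proof. by case: k. Qed.

Lemma re1 : re (1 : K) = 1.
Proof. by case: k. Qed.

Lemma re_of_realM a z : re (of_real a * z) = a * re z.
Proof.
by rewrite /of_real; case: k z => //= -[x y] /=; rewrite mul0r subr0.
Qed.

Lemma le_re z w : z <= w -> re z <= re w.
Proof. by case: k z w => //= -[? ?] [? ?] /andP[]. Qed.

(** Over the complex numbers the order itself forces the imaginary part of [z] to vanish. Norms in
    [K] can thus be moved to [R] and back. *)
Lemma ge0_of_real z : 0 <= z -> of_real (re z) = z.
Proof.
by rewrite /of_real; case: k z => //= -[x y]; rewrite lecE/= => /andP[/eqP->].
Qed.

Lemma ler_of_real a b : (of_real a <= of_real b) = (a <= b).
Proof. by rewrite /of_real; case: k => //=; rewrite lecR. Qed.

Lemma of_real_norm a : `|of_real a| = of_real `|a|.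
Proof.
rewrite /of_real; case: k => //=.
by apply: etrans (normc_def _) _; rewrite /= expr0n addr0 sqrtr_sqr.
Qed.

Lemma re_le_norm z : re z <= re `|z|.
Proof.
case: k z => //= [z|z]; first exact: ler_norm.
suff h (w : R[i]%C) : complex.Re w <= complex.Re `|w| by exact: h.
rewrite normc_def/= (le_trans (ler_norm _))// -sqrtr_sqr ler_sqrt.
  by rewrite lerDl sqr_ge0.
by rewrite addr_ge0 ?sqr_ge0.
Qed.

End Scalars.
Arguments of_real {R} k a.

(** * Finite nets of the unimodular scalars *)

(** One point of [P] is chosen in each fibre of [c] that meets [P]. With [c] a grid cell, the net
    obtained consists of unimodular scalars rather than grid points. *)
Lemma fibre_representatives (T : eqType) (I : finType) (c : T -> I) (P : set T) :
  exists s : seq T, {in s, forall t, P t} /\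
    forall x, P x -> exists2 t, t \in s & c t = c x.
Proof.
pose r i :=
  if pselect (exists t, P t /\ c t = i) is left e
  then Some (sval (cid e)) else None.
have rP i t : r i = Some t -> P t /\ c t = i.
  by rewrite /r; case: pselect => // e [<-]; exact: svalP (cid e).
exists (pmap r (enum I)); split=> [t|x Px].
  by rewrite mem_pmap => /mapP[i _ /esym/rP[]].
have [t rt] : exists t, r (c x) = Some t.
  rewrite /r; case: pselect => [e|[]]; last by exists x.
  by exists (sval (cid e)).
exists t; last by have [] := rP _ _ rt.
by rewrite mem_pmap -rt map_f// mem_enum.
Qed.

(** On [[-1, 1]] the number [M (a + 1)] lies in [[0, 2M]], endpoint included, so [2M + 1] cells are
    needed for [inord] to be faithful. Equal truncations then put the two scaled numbers in one
    half-open interval of length one. *)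
Lemma truncn_cell (R : realType) (M : nat) (a b : R) :
  (0 < M)%N -> -1 <= a <= 1 -> -1 <= b <= 1 ->
  inord (Num.truncn (M%:R * (a + 1))) = inord (Num.truncn (M%:R * (b + 1))) :> 'I_(2 * M).+1 ->
  `|a - b| < M%:R^-1.
Proof.
move=> M0 a1 b1; have {}M0 : 0 < M%:R :> R by rewrite ltr0n.
have bound (x : R) : -1 <= x <= 1 ->
    0 <= M%:R * (x + 1) /\ (Num.truncn (M%:R * (x + 1)) < (2 * M).+1)%N.
  move=> x1; have x0 : 0 <= M%:R * (x + 1) by rewrite mulr_ge0//; lra.
  split=> //; rewrite truncn_lt_nat// -natr1 natrM.
  have : M%:R * (x + 1) <= M%:R * 2 by rewrite ler_pM2l//; lra.
  lra.
have [a0 aM] := bound a a1; have [b0 bM] := bound b b1.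
move=> /(congr1 (@nat_of_ord _)); rewrite !inordK// => ab.
have := truncn_itv a0; have := truncn_itv b0; rewrite -{}ab -natr1.
set n := _%:R; move=> bn an; rewrite -(ltr_pM2l M0) divff ?gt_eqF//.
have -> : M%:R * `|a - b| = `|M%:R * (a + 1) - M%:R * (b + 1)|.
  by rewrite -mulrBr opprD addrACA subrr addr0 normrM gtr0_norm.
by rewrite ltr_norml; lra.
Qed.

Lemma unimodular_net (R : realType) (k : scalar_kind) (d : R) : 0 < d ->
  exists s : seq (scalars R k), {in s, forall t, `|t| = 1} /\
    forall z : scalars R k, `|z| = 1 -> exists2 t, t \in s & re `|z - t| < d.
Proof.
move=> d0; case: k => /=.
  exists [:: 1; -1]; split=> [t|z z1].
    by rewrite !inE => /orP[] /eqP->; rewrite ?normrN normr1.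
  have [z0|z0] := leP 0 z.
    by exists z; rewrite ?subrr ?normr0// -z1 ger0_norm// inE eqxx.
  exists z; rewrite ?subrr ?normr0// !inE -[z]opprK -(ltr0_norm z0) z1 eqxx.
  by rewrite orbT.
(* The real and imaginary parts each contribute an error below [1 / M], so [M] must exceed
   [2 / d]. *)
pose M := (Num.truncn (2 / d)).+1.
have Md : M%:R^-1 + M%:R^-1 < d.
  have M0 : 0 < M%:R :> R by rewrite ltr0n.
  have : 2 / d < M%:R by exact: truncnS_gt.
  have -> : M%:R^-1 + M%:R^-1 = 2 / M%:R :> R by lra.
  by rewrite !ltr_pdivrMr// mulrC.
pose cell (a : R) : 'I_(2 * M).+1 := inord (Num.truncn (M%:R * (a + 1))).
have [s [sP sc]] := fibre_representatives
  (fun z : R[i]%C => (cell (complex.Re z), cell (complex.Im z)))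
  [set z : R[i]%C | `|z| = 1].
exists s; split=> [//|z z1].
have bound (w : R[i]%C) : `|w| = 1 ->
    (-1 <= complex.Re w <= 1) && (-1 <= complex.Im w <= 1).
  rewrite normc_def => /(congr1 (@complex.Re R))/= w1.
  have := @sqr_sqrtr R (complex.Re w ^+ 2 + complex.Im w ^+ 2).
  rewrite w1 expr1n addr_ge0 ?sqr_ge0// => /(_ isT) {}w1.
  by apply/andP; split; apply/andP; split; nra.
have [t ts [tre tim]] := sc z z1; exists t => //.
have /andP[tr ti] := bound t (sP t ts); have /andP[zr zi] := bound z z1.
suff h (w : R[i]%C) : complex.Re `|w| <= `|complex.Re w| + `|complex.Im w|.
  have hi := truncn_cell (ltn0Sn _) zi ti (esym tim).
  have hr := truncn_cell (ltn0Sn _) zr tr (esym tre).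
  apply: le_lt_trans (h _) (lt_trans (ltrD _ _) Md).
    by case: z t {zr zi tr ti tre tim ts z1 hi} hr => [x y] [x' y'].
  by case: z t {zr zi tr ti tre tim ts z1 hr} hi => [x y] [x' y'].
rewrite normc_def/= -[leRHS]ger0_norm ?addr_ge0// -sqrtr_sqr ler_sqrt ?sqr_ge0//.
rewrite sqrrD !real_normK ?num_real// lerD2r lerDl.
by rewrite mulrn_wge0// mulr_ge0.
Qed.

(** * Restriction of scalars to the reals and recovery of a functional from its real part *)

Section RealRestriction.
Variables (R : realType) (k : scalar_kind).

(** The alias keeps the module structure over [R] apart from the one over [K] on the same additive
    group. *)
Definition real_restriction (X : lmodType (scalars R k)) : Type := X.

Variable X : lmodType (scalars R k).
HB.instance Definition _ := GRing.Zmodule.on (real_restriction X).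

Let scale (a : R) (x : real_restriction X) : real_restriction X :=
  of_real k a *: (x : X).

Let scaleA a b x : scale a (scale b x) = scale (a * b) x.
Proof. by rewrite /scale scalerA of_realM. Qed.

Let scale1 x : scale 1 x = x.
Proof. by rewrite /scale of_real1 scale1r. Qed.

Let scaleDr a x y : scale a (x + y) = scale a x + scale a y.
Proof. by rewrite /scale scalerDr. Qed.

Let scaleDl x a b : scale (a + b) x = scale a x + scale b x.
Proof. by rewrite /scale of_realD scalerDl. Qed.

HB.instance Definition _ := GRing.Zmodule_isLmodule.Build R
  (real_restriction X) scaleA scale1 scaleDr scaleDl.

Lemma real_restrictionZ (a : R) (x : X) :
  (a *: (x : real_restriction X) : real_restriction X) = of_real k a *: x :> X.
Proof. by []. Qed.

End RealRestriction.

(* Over the complex numbers, [g z = u z - i u (i z)]. *)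
Lemma scalar_of_real_part (R : realType) (k : scalar_kind)
    (X : lmodType (scalars R k)) (u : {scalar real_restriction X}) :
  exists g : {scalar X}, forall z, re (g z) = u z.
Proof.
case: k X u => X u.
  have ulin : linear_for *%R (u : X -> scalars R RealScalars).
    by move=> a x y; rewrite (linearP u a x y).
  pose L := GRing.isLinear.Build (scalars R RealScalars) X
    (scalars R RealScalars) *%R _ ulin.
  pose f : {scalar X} := HB.pack (u : X -> scalars R RealScalars) L.
  by exists f.
pose g (z : X) : scalars R ComplexScalars := (u z +i* - u ('i%C *: z))%C.
have uD x y : u (x + y : X) = u x + u y by exact: (raddfD u x y).
have uZ a x : u (a%:C%C *: x : X) = a * u x by exact: (linearZ_LR u a x).
have glin : linear_for *%R g.
  move=> [a b] x y; rewrite /g.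
  (* This splitting, [ii] and [comm] reduce complex linearity of [g] to real linearity of [u]. *)
  have ab (z : X) : (a +i* b)%C *: z = a%:C%C *: z + b%:C%C *: ('i%C *: z).
    by rewrite scalerA -scalerDl; congr (_ *: _); simpc.
  have ii (z : X) : 'i%C *: ('i%C *: z) = (-1)%:C%C *: z.
    by rewrite scalerA; congr (_ *: _); simpc.
  have comm c (z : X) : 'i%C *: (c%:C%C *: z) = c%:C%C *: ('i%C *: z).
    by rewrite !scalerA mulrC.
  rewrite scalerDr ab scalerDr !comm ii !uD !uZ; apply/eqP; rewrite eq_complex/=.
  by apply/andP; split; apply/eqP; ring.
pose L := GRing.isLinear.Build (scalars R ComplexScalars) X
  (scalars R ComplexScalars) *%R _ glin.
pose f : {scalar X} := HB.pack g L.
by exists f.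
Qed.

(** * Norming functionals, slices and Daugavet points *)

Section Slices.
Variables (R : realType) (k : scalar_kind) (X : normedModType (scalars R k)).
Local Notation K := (scalars R k).
Implicit Types (x y z : X) (f g : {scalar X}) (S : set X).

Lemma of_real_rnorm x : of_real k (rnorm x) = `|x|.
Proof. exact: ge0_of_real. Qed.

Lemma rnormD x y : rnorm (x + y) <= rnorm x + rnorm y.
Proof. by rewrite /rnorm -reD le_re// ler_normD. Qed.

Lemma rnormZ (a : K) x : rnorm (a *: x) = re `|a| * rnorm x.
Proof. by rewrite /rnorm normrZ -(ge0_of_real (normr_ge0 a)) re_of_realM of_realK. Qed.

Lemma rnormN x : rnorm (- x) = rnorm x.
Proof. by rewrite /rnorm normrN. Qed.

Lemma rnorm0 : rnorm (0 : X) = 0.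
Proof. by rewrite /rnorm normr0 re0. Qed.

Lemma rnorm_unimodularZ (t : K) x : `|t| = 1 -> rnorm (t *: x) = rnorm x.
Proof. by move=> t1; rewrite rnormZ t1 re1 mul1r. Qed.

Lemma rnorm_sublinear : sublinear (fun x : real_restriction X => rnorm (x : X)).
Proof.
split=> [x y|a x a0]; first exact: rnormD.
by rewrite real_restrictionZ rnormZ of_real_norm of_realK ger0_norm.
Qed.

Lemma le_rnorm_continuous f : (forall z, re (f z) <= rnorm z) -> continuous f.
Proof.
move=> fle; have fn z : `|f z| <= `|z|.
  have [->|fz0] := eqVneq (f z) 0; first by rewrite normr0.
  (* Multiplying [z] by this unimodular scalar keeps its norm and turns [f z] into [|f z|], so the
     bound on the real part bounds the modulus. *)
  have := fle (`|f z| / f z *: z).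
  rewrite linearZ/= divfK// rnormZ normf_div normr_id divff ?normr_eq0//.
  rewrite re1 mul1r => h; rewrite -of_real_rnorm -(ge0_of_real (normr_ge0 (f z))).
  by rewrite ler_of_real.
pose f' : {linear X -> K^o} := f.
apply: (@bounded_linear_continuous _ X K^o f'); apply/linear_boundedP.
near=> r => z; apply: le_trans (fn z) _; rewrite ler_peMl//.
Unshelve. all: by end_near. Qed.

Lemma norming_functional x : exists g,
  [/\ continuous g, forall z, re (g z) <= rnorm z & re (g x) = rnorm x].
Proof.
have [u [ule ux]] := sublinear_hahn_banach (x : real_restriction X) rnorm_sublinear.
have [g gu] := scalar_of_real_part u.
have gle z : re (g z) <= rnorm z by rewrite gu ule.
by exists g; split; [exact: le_rnorm_continuous | | rewrite gu ux].
Qed.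

Definition ball_values f : set R := [set re (f z) | z in @unit_ball R k X].

Lemma ball_values_has_ubound f : continuous f -> has_ubound (ball_values f).
Proof.
move=> cf; pose f' : {linear X -> K^o} := f.
have /linear_boundedP := @continuous_linear_bounded _ X K^o 0 f' (cf 0).
move=> /pinfty_ex_gt0[M M0 fM]; exists (re M) => _ [z z1 <-].
apply: le_trans (re_le_norm _) (le_re _).
apply: le_trans (fM z) _; rewrite ler_piMr ?(ltW M0)//.
by rewrite -of_real_rnorm -(of_real1 R k) ler_of_real.
Qed.

Lemma ball_values_le_sup f z : continuous f -> unit_ball z ->
  re (f z) <= sup (ball_values f).
Proof.
by move=> cf z1; apply: ub_le_sup; [exact: ball_values_has_ubound | exists z].
Qed.

(** The depth is the supremum of [re f] on the ball minus [c]. The point [y] makes it positive and,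
    as [c >= 0], also shows that [f] is nonzero. *)
Lemma is_slice_superlevel f (c : R) y : continuous f -> unit_ball y ->
  0 <= c -> c < re (f y) -> is_slice [set z | unit_ball z /\ c < re (f z)].
Proof.
move=> cf y1 c0 cy; exists f, (sup (ball_values f) - c); split => //.
- by move=> f0; move: cy; rewrite f0 /cst re0 ltNge c0.
- by rewrite subr_gt0 (lt_le_trans cy)// ball_values_le_sup.
- by rewrite /slice opprB addrC subrK.
Qed.

(** The ball is invariant under [t], so [f] composed with [t] has the same supremum on it and the
    depth is unchanged. *)
Lemma is_slice_rotate S (t : K) : `|t| = 1 -> is_slice S ->
  is_slice [set y | S (t *: y)].
Proof.
move=> t1 [f [a [cf f0 a0 ->]]].
have t0 : t != 0 by rewrite -normr_eq0 t1 oner_neq0.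
pose g : {scalar X} := (f \o *:%R t).
have tball z : unit_ball (t *: z) = unit_ball z.
  by rewrite /unit_ball/= rnorm_unimodularZ.
have gvals : ball_values g = ball_values f.
  apply/seteqP; split=> [_ [z z1 <-]|_ [z z1 <-]].
    by exists (t *: z); rewrite ?tball.
  exists (t^-1 *: z); last by rewrite /= scalerA divff// scale1r.
  by rewrite -tball scalerA divff// scale1r.
exists g, a; split => //.
- by move=> z; apply: continuous_comp; [exact: scaler_continuous | exact: cf].
- move=> g0; apply: f0; apply/funext => z.
  by have := congr1 (fun h => h (t^-1 *: z)) g0; rewrite /= scalerA divff// scale1r.
- by rewrite /slice/= -/(ball_values g) gvals; under eq_set do rewrite tball.
Qed.

Lemma daugavet_point_sub x S (e : R) : daugavet_point x -> is_slice S -> 0 < e ->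
  exists T, [/\ is_slice T, T `<=` S & forall y, T y -> 2 - e < rnorm (x + y)].
Proof.
move=> [x1 dx] [f [a [cf f0 a0 ->]]] e0.
(* The final estimate loses [3 * d], which must stay within [e]; inclusion in the original slice
   costs [2 * d], to be covered by [a]; the bound by [1] keeps the level [M - 2 * d + 1]
   nonnegative. *)
pose d := Num.min a (Num.min e 1) / 3.
have m0 : 0 < Num.min a (Num.min e 1) by rewrite !lt_min a0 e0/=.
have d0 : 0 < d by rewrite divr_gt0.
have [da de d1] : [/\ 3 * d <= a, 3 * d <= e & 3 * d <= 1].
  rewrite /d mulrCA divff// mulr1; split; rewrite !ge_min lexx ?orbT//.
have Sd : is_slice (slice f d) by exists f, d; split.
have dxS := dx _ Sd.
(* [sup] is [0] by default on a set without a supremum, so the value [2] shows that this set is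
   nonempty and bounded. *)
have hs : has_sup [set rnorm (x + y) | y in slice f d].
  by apply: contrapT => /sup_out; rewrite dxS => /eqP; rewrite pnatr_eq0.
have [_ [y [y1 fy] <-]] := sup_adherent d0 hs; rewrite dxS => xy.
have [g [cg gle gxy]] := norming_functional (x + y).
pose M := sup (ball_values f).
rewrite -/(ball_values f) -/M in fy.
have fM z : unit_ball z -> re (f z) <= M by exact: ball_values_le_sup.
have M0 : 0 <= M by rewrite -(re0 R k) -(linear0 f) fM// /unit_ball/= rnorm0.
have g1 z : unit_ball z -> re (g z) <= 1 by exact: le_trans (gle z).
have gx1 : re (g x) <= 1 by rewrite g1// /unit_ball/= x1.
rewrite -gxy linearD reD in xy.
pose h : {scalar X} := (f \+ g).
(* At [y], [re f > M - d] and [re g > 1 - d], so [y] lies in this set. Since [re f <= M] and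
   [re g <= 1] on the ball, its points satisfy [re f > M - 2 * d] and [re g > 1 - 2 * d]. *)
exists [set z | unit_ball z /\ M - 2 * d + 1 < re (h z)]; split.
- apply: (@is_slice_superlevel h _ y) => //.
  + by move=> z; exact: (@continuousD _ K^o X f g z (cf z) (cg z)).
  + lra.
  + by rewrite /h/= reD; have := g1 y y1; lra.
- move=> z [z1]; rewrite /h/= reD => hz; split => //.
  by rewrite -/(ball_values f) -/M; have := g1 z z1; lra.
- move=> z [z1]; rewrite /h/= reD => hz.
  apply: lt_le_trans (gle (x + z)); rewrite linearD reD.
  by have := fM z z1; have := g1 y y1; lra.
Qed.

Lemma daugavet_point_rotate_sub x S (t : K) (e : R) : daugavet_point x ->
  is_slice S -> `|t| = 1 -> 0 < e ->
  exists T, [/\ is_slice T, T `<=` S & forall y, T y -> 2 - e < rnorm (x + t *: y)].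
Proof.
move=> dx Ssl t1 e0.
have t0 : t != 0 by rewrite -normr_eq0 t1 oner_neq0.
have tV1 : `|t^-1| = 1 by rewrite normfV t1 invr1.
(* The case of scalar one is applied to the rotated slice [t S]; rotating the resulting [T] back by
   [t^-1] lands in [S]. *)
have [T [Tsl TS xT]] := daugavet_point_sub dx (is_slice_rotate tV1 Ssl) e0.
exists [set y | T (t *: y)]; split=> [|y /TS|y /xT//].
  exact: is_slice_rotate.
by rewrite /= scalerA mulVf// scale1r.
Qed.

Lemma daugavet_point_seq_sub x S (s : seq K) (e : R) : daugavet_point x ->
  is_slice S -> 0 < e -> {in s, forall t, `|t| = 1} ->
  exists T, [/\ is_slice T, T `<=` S &
    forall y t, T y -> t \in s -> 2 - e < rnorm (x + t *: y)].
Proof.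
move=> dx Ssl e0; elim: s => [|t s IHs] s1; first by exists S; split=> [||y t _].
have [r rs|T [Tsl TS xT]] := IHs; first by apply: s1; rewrite inE rs orbT.
have [|U [Usl UT xU]] := daugavet_point_rotate_sub dx Tsl (s1 t _) e0.
  by rewrite inE eqxx.
(* As [U] lies in [T], the estimates for the earlier scalars persist. *)
exists U; split=> [//|y /UT/TS//|y r Uy].
by rewrite inE => /predU1P[->|]; [exact: xU | exact/xT/UT].
Qed.

End Slices.

Theorem proposition4p8 (R : realType) (k : scalar_kind)
    (X : completeNormedModType (scalars R k)) (x : X) :
  unit_sphere x -> daugavet_point x ->
  forall (S : set X) (eps : R), is_slice S -> 0 < eps ->
  exists T : set X,
    [/\ is_slice T, T `<=` S &
        forall (y : X) (theta : scalars R k), T y -> `|theta| = 1 ->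
          rnorm (x + theta *: y) > 2 - eps].
Proof.
move=> _ dx S eps Ssl eps0; have eps2 : 0 < eps / 2 by rewrite divr_gt0.
have [s [s1 snet]] := unimodular_net k eps2.
have [T [Tsl TS xT]] := daugavet_point_seq_sub dx Ssl eps2 s1.
exists T; split=> // y z Ty z1; have [t ts zt] := snet z z1.
have y1 : rnorm y <= 1 by have [f [a [_ _ _ TE]]] := Tsl; move: Ty; rewrite TE => -[].
(* Replacing [z] by the net point [t] costs at most [|z - t| < eps / 2], as [y] is in the ball; the
   other half of [eps] is spent on the estimate for [t]. *)
have h : rnorm (x + t *: y) <= rnorm (x + z *: y) + rnorm ((z - t) *: y).
  have -> : x + t *: y = (x + z *: y) - (z - t) *: y.
    by rewrite scalerBl opprB -addrA [z *: y + _]addrC subrK.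
  by rewrite -[rnorm ((z - t) *: y)]rnormN rnormD.
have hzt : rnorm ((z - t) *: y) <= re `|z - t|.
  by rewrite rnormZ ler_piMr// -(re0 R k) le_re.
by have := xT y t Ty ts; lra.
Qed.
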